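(* Let $\mathbf A\in\mathbb H^{m\times n}$, $\mathbf y\in\mathbb H^{1\times n}$, and let $\mathbf x^{0}=(x^0_1,\dots,x^0_m)$ be the least squares solution of least norm of the left system $\mathbf x\mathbf A=\mathbf y$. Put $\mathbf z=\mathbf y\mathbf A^{*}$. (i) If $\operatorname{rank}\mathbf A=m$, then for all $i=1,\dots,m$, $x_i^0=\dfrac{\operatorname{rdet}_i\big((\mathbf A\mathbf A^{*})_{i.}(\mathbf z)\big)}{\operatorname{ddet}\mathbf A}$. (ii) If $\operatorname{rank}\mathbf A=k\le n<m$, then for all $i=1,\dots,m$, $x_i^0=\dfrac{\sum_{\alpha\in I_{k,m}\{i\}}\operatorname{rdet}_i\Big(\big((\mathbf A\mathbf A^{*})_{i.}(\mathbf z)\big)^{\alpha}_{\alpha}\Big)}{\sum_{\alpha\in I_{k,m}}\big|(\mathbf A\mathbf A^{*})^{\alpha}_{\alpha}\big|}$.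
   Context: $\mathbb H$ is the quaternion skew field, $\mathbf A^*$ the conjugate transpose. The rank of a quaternion matrix is the maximal number of right-linearly independent columns (equivalently left-linearly independent rows). For a row $\mathbf x\in\mathbb H^{1\times m}$, $\|\mathbf x\|=\sqrt{\mathbf x\mathbf x^*}$. The least squares solution of least norm of $\mathbf x\mathbf A=\mathbf y$ is the row $\mathbf x^0$ of minimal norm among all $\tilde{\mathbf x}$ minimizing $\|\tilde{\mathbf x}\mathbf A-\mathbf y\|$. $\operatorname{ddet}\mathbf A:=\det(\mathbf A\mathbf A^* )$. Row and column determinants of $\mathbf M=(m_{ij})\in\mathbb H^{n\times n}$: $\operatorname{rdet}_i\mathbf M=\sum_{\sigma\in S_n}(-1)^{n-r}m_{i\,i_{k_1}}m_{i_{k_1}i_{k_1+1}}\cdots m_{i_{k_1+l_1}\,i}\cdots m_{i_{k_r}i_{k_r+1}}\cdots m_{i_{k_r+l_r}i_{k_r}}$ with $\sigma=(i\,i_{k_1}\dots i_{k_1+l_1})(i_{k_2}\dots i_{k_2+l_2})\cdots(i_{k_r}\dots i_{k_r+l_r})$ its decomposition into $r$ disjoint cycles (fixed points included), first cycle starting with $i$, other cycles starting with their smallest element, $i_{k_2}<\dots<i_{k_r}$; $\operatorname{cdet}_j$ is defined analogously with products read from the right. For Hermitian $\mathbf M$ all $\operatorname{rdet}_i\mathbf M$, $\operatorname{cdet}_j\mathbf M$ coincide and are real; the common value is $\det\mathbf M$. $\mathbf M_{i.}(\mathbf z)$ is $\mathbf M$ with its $i$th row replaced by the row $\mathbf z$.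 $L_{k,m}$ is the set of strictly increasing $k$-sequences from $\{1,\dots,m\}$, $I_{k,m}=L_{k,m}$, $I_{k,m}\{i\}=\{\alpha\in L_{k,m}:i\in\alpha\}$. $\mathbf M^{\alpha}_{\alpha}$ is the principal submatrix with rows and columns in $\alpha$; $|\mathbf M^\alpha_\alpha|=\det\mathbf M^\alpha_\alpha$ for Hermitian $\mathbf M$. In $\operatorname{rdet}_i(\mathbf N^\alpha_\alpha)$, $i\in\alpha$, the subscript refers to the row of the submatrix coming from row $i$ of $\mathbf N$. *)

(* Defs.v *)
(* Quaternions over a real closed field R (R = the reals is the
   intended instance), quaternion matrices, Kyrchei's row determinants. *)
From HB Require Import structures.
From mathcomp Require Import all_boot all_order all_algebra all_fingroup.
From mathcomp Require Import ring.

Set Implicit Arguments.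
Unset Strict Implicit.
Unset Printing Implicit Defensive.

Import Order.TTheory GRing.Theory Num.Theory.
Local Open Scope ring_scope.

Section Quaternions.
Variable R : rcfType.

Record quat := Quat { qre : R; qi : R; qj : R; qk : R }.

Definition quat2tuple (q : quat) := (qre q, qi q, qj q, qk q).
Definition tuple2quat (t : R * R * R * R) :=
  let: (a, b, c, d) := t in Quat a b c d.
Lemma quat2tupleK : cancel quat2tuple tuple2quat. Proof. by case. Qed.

HB.instance Definition _ := Equality.copy quat (can_type quat2tupleK).
HB.instance Definition _ := Choice.copy quat (can_type quat2tupleK).

Definition qzero := Quat 0 0 0 0.
Definition qone := Quat 1 0 0 0.
Definition qadd (p q : quat) :=
  Quat (qre p + qre q) (qi p + qi q) (qj p + qj q) (qk p + qk q).
Definition qopp (p : quat) := Quat (- qre p) (- qi p) (- qj p) (- qk p).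
(* Hamilton product: i^2 = j^2 = k^2 = ijk = -1 *)
Definition qmul (p q : quat) :=
  Quat (qre p * qre q - qi p * qi q - qj p * qj q - qk p * qk q)
       (qre p * qi q + qi p * qre q + qj p * qk q - qk p * qj q)
       (qre p * qj q - qi p * qk q + qj p * qre q + qk p * qi q)
       (qre p * qk q + qi p * qj q - qj p * qi q + qk p * qre q).
Definition qconj (p : quat) := Quat (qre p) (- qi p) (- qj p) (- qk p).
Definition qnorm2 (p : quat) := qre p ^+ 2 + qi p ^+ 2 + qj p ^+ 2 + qk p ^+ 2.
(* embedding of reals and the inverse (p^-1 = conj p / |p|^2, 0^-1 = 0) *)
Definition qreal (r : R) := Quat r 0 0 0.
Definition qinv (p : quat) := qmul (qreal (qnorm2 p)^-1) (qconj p).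

Lemma qaddA : associative qadd.
Proof. by move=> [? ? ? ?] [? ? ? ?] [? ? ? ?]; rewrite /qadd /=; congr Quat; ring. Qed.
Lemma qaddC : commutative qadd.
Proof. by move=> [? ? ? ?] [? ? ? ?]; rewrite /qadd /=; congr Quat; ring. Qed.
Lemma qadd0 : left_id qzero qadd.
Proof. by move=> [? ? ? ?]; rewrite /qadd /=; congr Quat; ring. Qed.
Lemma qaddN : left_inverse qzero qopp qadd.
Proof. by move=> [? ? ? ?]; rewrite /qadd /=; congr Quat; ring. Qed.

HB.instance Definition _ := GRing.isZmodule.Build quat qaddA qaddC qadd0 qaddN.

Lemma qmulA : associative qmul.
Proof. by move=> [? ? ? ?] [? ? ? ?] [? ? ? ?]; rewrite /qmul /=; congr Quat; ring. Qed.
Lemma qmul1 : left_id qone qmul.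
Proof. by move=> [? ? ? ?]; rewrite /qmul /=; congr Quat; ring. Qed.
Lemma qmulr1 : right_id qone qmul.
Proof. by move=> [? ? ? ?]; rewrite /qmul /=; congr Quat; ring. Qed.
Lemma qmulDl : left_distributive qmul qadd.
Proof. by move=> [? ? ? ?] [? ? ? ?] [? ? ? ?]; rewrite /qmul /qadd /=; congr Quat; ring. Qed.
Lemma qmulDr : right_distributive qmul qadd.
Proof. by move=> [? ? ? ?] [? ? ? ?] [? ? ? ?]; rewrite /qmul /qadd /=; congr Quat; ring. Qed.
Lemma qone_neq0 : qone != qzero.
Proof. by apply/eqP => -[] /eqP; rewrite oner_eq0. Qed.

HB.instance Definition _ :=
  GRing.Zmodule_isNzRing.Build quat qmulA qmul1 qmulr1 qmulDl qmulDr qone_neq0.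

End Quaternions.

Section QuatMatrices.
Variable R : rcfType.
Local Notation H := (quat R).

Definition qadj m n (A : 'M[H]_(m, n)) : 'M[H]_(n, m) :=
  \matrix_(i, j) qconj (A j i).

(* ||x|| = sqrt (x x^* ) for a row x (x x^* is a real 1x1 matrix) *)
Definition rnorm n (x : 'rV[H]_n) : R := Num.sqrt (qre ((x *m qadj x) 0 0)).

Definition right_indep_cols m n (A : 'M[H]_(m, n)) (S : {set 'I_n}) : Prop :=
  forall c : 'I_n -> H,
    (forall i, \sum_(j in S) A i j * c j = 0) -> forall j, j \in S -> c j = 0.

Definition qrank_is m n (A : 'M[H]_(m, n)) (k : nat) : Prop :=
  (exists S : {set 'I_n}, #|S| = k /\ right_indep_cols A S) /\
  (forall S : {set 'I_n}, right_indep_cols A S -> (#|S| <= k)%N).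

Definition lsq_least_norm m n (A : 'M[H]_(m, n)) (y : 'rV[H]_n)
    (x0 : 'rV[H]_m) : Prop :=
  (forall x : 'rV[H]_m, rnorm (x0 *m A - y) <= rnorm (x *m A - y)) /\
  (forall x : 'rV[H]_m, rnorm (x *m A - y) = rnorm (x0 *m A - y) ->
                         rnorm x0 <= rnorm x).

Definition cycle_prod n (M : 'M[H]_n) (s : 'S_n) (a : 'I_n) : H :=
  \prod_(t < #|porbit s a|) M (iter t s a) (iter t.+1 s a).

Definition cycle_min n (s : 'S_n) (a : 'I_n) : bool :=
  [forall b in porbit s a, (a <= b)%N].

(* row determinant rdet_i: first the cycle through i, then the remaining
   cycles ordered by increasing smallest element, each started at its
   smallest element; sign (-1)^(n - r), r = number of cycles *)
Definition rdet n (i : 'I_n) (M : 'M[H]_n) : H :=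
  \sum_(s : 'S_n)
    (- 1) ^+ (n - #|porbits s|) *
    (cycle_prod M s i *
     \prod_(a < n | (a \notin porbit s i) && cycle_min s a) cycle_prod M s a).

(* determinant of a Hermitian matrix: the common value of its row
   determinants; literally rdet_1 (for n >= 1; the cycle through the first
   index is then automatically first), and 1 for the empty matrix. *)
Definition hdet n (M : 'M[H]_n) : H :=
  \sum_(s : 'S_n)
    (- 1) ^+ (n - #|porbits s|) *
    \prod_(a < n | cycle_min s a) cycle_prod M s a.

Definition ddet m n (A : 'M[H]_(m, n)) : H := hdet (A *m qadj A).

Definition row_repl m (M : 'M[H]_m) (i : 'I_m) (z : 'rV[H]_m) : 'M[H]_m :=
  \matrix_(a, b) if a == i then z 0 b else M a b.

(* principal submatrix M^alpha_alpha, alpha listed increasingly *)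
Definition psubmx m (M : 'M[H]_m) (alpha : {set 'I_m}) : 'M[H]_#|alpha| :=
  \matrix_(a, b) M (enum_val a) (enum_val b).

Definition rdet_pos n (p : nat) (M : 'M[H]_n) : H :=
  if insub p is Some i then rdet i M else 0.

(* rdet_i (N^alpha_alpha) for i in alpha: the row of the submatrix coming
   from row i of N is the position of i in the increasing enumeration of alpha *)
Definition rdet_sub m (i : 'I_m) (N : 'M[H]_m) (alpha : {set 'I_m}) : H :=
  rdet_pos (index i (enum alpha)) (psubmx N alpha).

End QuatMatrices.

(* Main.v *)
(**
Expand the row determinant along the cycle through the chosen row. Deleting
the first step [i -> k] of that cycle gives, for
[F U c i = rdet_i (M_{i.}(row c M))^U_U] and [D U = |M^U_U|], the recursion
[F U c i = M c i * D (U \ i) - sum_(k in U \ i) M c k * F (U \ k) k i].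
Hence [F U c i] is the subset convolution of [D] with signed sums over
self-avoiding paths from [c] to [i]. For Hermitian [M] the closed path sums
are real, since reversing a path conjugates its product; rotating a cycle
preserves real parts. It follows that [D] is real, that [F U i i = D U], and
that [F U c i = 0] for distinct [c, i] in [U].

Summing over all [U] of size [l] gives
[S_l (u M) + S_(l+1) u = u_i * d_l], where [S_l z] is the numerator and [d_l]
the denominator of the Cramer formula. Take [M = A A^*], [l = rank A] and
[u = x0], so that [u M = y A^*] by the normal equations. A minor [D U] with
[#|U| > l] vanishes, its cofactor row then lies in the left kernel of [A],
and [x0] is orthogonal to that kernel, so [S_(l+1) x0 = 0]. Finally
[d_l > 0] because a Gram minor is positive exactly when the rows are
independent.
*)
Require Import Defs.
From mathcomp Require Import all_boot all_order all_algebra all_fingroup.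
From mathcomp Require Import ring lra.

Set Implicit Arguments.
Unset Strict Implicit.
Unset Printing Implicit Defensive.

Import Order.TTheory GRing.Theory Num.Theory.
Local Open Scope ring_scope.

(** * Quaternions *)

Section QuaternionFacts.
Variable R : rcfType.
Implicit Types p q : quat R.

Lemma qconjD p q : qconj (p + q) = qconj p + qconj q.
Proof. by case: p q => [????] [????]; congr Quat; rewrite /= ?opprD. Qed.

Lemma qconj0 : qconj 0 = 0 :> quat R.
Proof. by congr Quat; rewrite /= ?oppr0. Qed.

Lemma qconj1 : qconj 1 = 1 :> quat R.
Proof. by congr Quat; rewrite /= ?oppr0. Qed.

Lemma qconjN q : qconj (- q) = - qconj q.
Proof. by case: q => ????; congr Quat. Qed.

Lemma qconjM p q : qconj (p * q) = qconj q * qconj p.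
Proof. by case: p q => [????] [????]; congr Quat => /=; ring. Qed.

Lemma qconjK : involutive (@qconj R).
Proof. by case=> ????; congr Quat; rewrite /= ?opprK. Qed.

Lemma qconj_sum (I : Type) (r : seq I) (P : pred I) (E : I -> quat R) :
  qconj (\sum_(i <- r | P i) E i) = \sum_(i <- r | P i) qconj (E i).
Proof. exact: (big_morph _ qconjD qconj0). Qed.

Lemma qreD p q : qre (p + q) = qre p + qre q.
Proof. by []. Qed.

Lemma qreN q : qre (- q) = - qre q.
Proof. by []. Qed.

Lemma qre_sum (I : Type) (r : seq I) (P : pred I) (E : I -> quat R) :
  qre (\sum_(i <- r | P i) E i) = \sum_(i <- r | P i) qre (E i).
Proof. exact: (big_morph _ qreD). Qed.

Lemma qreMC p q : qre (p * q) = qre (q * p).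
Proof. by case: p q => [????] [????] /=; ring. Qed.

Lemma qre_mulconj q : qre (q * qconj q) = qnorm2 q.
Proof. by case: q => ???? /=; rewrite /qnorm2 /=; ring. Qed.

Lemma qnorm2_ge0 q : 0 <= qnorm2 q.
Proof. by rewrite /qnorm2 !addr_ge0 ?sqr_ge0. Qed.

Lemma qnorm2_eq0 q : (qnorm2 q == 0) = (q == 0).
Proof.
apply/eqP/eqP => [|->]; last by rewrite /qnorm2 /= expr0n /= !addr0.
case: q => a b c d; rewrite /qnorm2 /= => /eqP.
rewrite !paddr_eq0 ?addr_ge0 ?sqr_ge0 // !sqrf_eq0.
by move=> /andP[/andP[/andP[/eqP-> /eqP->] /eqP->] /eqP->].
Qed.

Lemma qmulV q : q != 0 -> q * qinv q = 1.
Proof.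
rewrite -qnorm2_eq0; case: q => a b c d.
rewrite /qinv; set n := qnorm2 _ => n0.
have nE : n = a ^+ 2 + b ^+ 2 + c ^+ 2 + d ^+ 2 by [].
(* Abstracting [n^-1] to [v] with [n * v = 1] leaves polynomial identities; only the real coordinate
   uses [nV]. *)
have := mulfV n0; clearbody n; move: n^-1 => v; rewrite {}nE => nV.
congr Quat => /=; try ring.
by rewrite -[in RHS]nV; ring.
Qed.

Lemma qmulVl q : q != 0 -> qinv q * q = 1.
Proof.
rewrite -qnorm2_eq0; case: q => a b c d.
rewrite /qinv; set n := qnorm2 _ => n0.
have nE : n = a ^+ 2 + b ^+ 2 + c ^+ 2 + d ^+ 2 by [].
have := mulfV n0; clearbody n; move: n^-1 => v; rewrite {}nE => nV.
congr Quat => /=; try ring.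
by rewrite -[in RHS]nV; ring.
Qed.

Lemma qconj_fixed q : qconj q = q -> q = qreal (qre q).
Proof.
case: q => a b c d [hb hc hd]; congr Quat => /=.
- by apply/eqP; rewrite -oppr_eq0 -[_ == 0](mulrn_eq0 _ 2) mulr2n {1}hb subrr.
- by apply/eqP; rewrite -oppr_eq0 -[_ == 0](mulrn_eq0 _ 2) mulr2n {1}hc subrr.
- by apply/eqP; rewrite -oppr_eq0 -[_ == 0](mulrn_eq0 _ 2) mulr2n {1}hd subrr.
Qed.

Lemma qrealC (r : R) q : qreal r * q = q * qreal r.
Proof. by case: q => ????; congr Quat => /=; ring. Qed.

Lemma qconj_fixedC p q : qconj p = p -> p * q = q * p.
Proof. by move/qconj_fixed->; exact: qrealC. Qed.

Lemma qre_inj_fixed p q :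
  qconj p = p -> qconj q = q -> qre p = qre q -> p = q.
Proof. by move=> /qconj_fixed-> /qconj_fixed-> /= ->. Qed.

End QuaternionFacts.

(** * Subset convolution and path sums *)

Section SubsetConvolution.
Variables (T : finType) (R : rcfType).
Local Notation H := (quat R).
Implicit Types (f g h : {set T} -> H) (A B U V : {set T}).

Definition conv f g A : H := \sum_(V : {set _} | V \subset A) f V * g (A :\: V).

Lemma eq_conv f1 f2 g1 g2 A :
  (forall V, V \subset A -> f1 V = f2 V) ->
  (forall V, V \subset A -> g1 V = g2 V) -> conv f1 g1 A = conv f2 g2 A.
Proof.
by move=> ef eg; apply: eq_bigr => V sV; rewrite ef // eg // subsetDl.
Qed.

Lemma conv_setD f g A :
  conv f g A = \sum_(V : {set _} | V \subset A) f (A :\: V) * g V.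
Proof.
rewrite /conv (reindex_onto (fun V => A :\: V) (fun V => A :\: V)) /=.
  apply: eq_big => [V|V].
    rewrite subsetDl setDDr setDv set0U andbC andbT.
    by apply/eqP/setIidPr.
  by case/andP=> _ /eqP->.
by move=> V sV; rewrite setDDr setDv set0U; apply/setIidPr.
Qed.

(** Both sides sum over ordered splittings of [A] into three disjoint blocks; the right side first
    names the union of the first two. *)
Lemma convA f g h A : conv f (conv g h) A = conv (conv f g) h A.
Proof.
rewrite /conv.
under eq_bigr do rewrite mulr_sumr.
under [RHS]eq_bigr do rewrite mulr_suml.
rewrite [RHS](exchange_big_dep (fun V : {set T} => V \subset A)) /=; last first.
  by move=> X V sX sV; apply: subset_trans sV sX.
apply: eq_bigr => V sVA.
rewrite [RHS](reindex_onto (fun U => V :|: U) (fun X => X :\: V)) /=; last first.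
  move=> X /andP[_ sVX]; apply/setP => x; rewrite !inE.
  by case: (boolP (x \in V)) => //= /(subsetP sVX).
have disjE (U : {set T}) : ((V :|: U) :\: V == U) = [disjoint U & V].
  rewrite setDUl setDv set0U; exact: (sameP eqP setDidPl).
apply: eq_big => [U|U].
  by rewrite subsetUl andbT subUset sVA /= disjE subsetD.
rewrite subsetD => /andP[_ dUV]; rewrite mulrA setDDl; congr (_ * g _ * _).
by apply/esym/eqP; rewrite disjE.
Qed.

(* Values fixed by conjugation are central, hence the commutativity. *)
Lemma convC f g A :
  (forall V, V \subset A -> qconj (f V) = f V) -> conv f g A = conv g f A.
Proof.
move=> fr; rewrite conv_setD; apply: eq_bigr => V sV.
by rewrite qconj_fixedC // fr // subsetDl.
Qed.

(** The real part is a trace form, blind to the order of two factors even when they do not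
    commute. *)
Lemma qre_convC f g A : qre (conv f g A) = qre (conv g f A).
Proof.
by rewrite conv_setD /conv !qre_sum; apply: eq_bigr => V _; rewrite qreMC.
Qed.

Lemma conv_fixed f g A :
  (forall V, V \subset A -> qconj (f V) = f V) ->
  (forall V, V \subset A -> qconj (g V) = g V) ->
  qconj (conv f g A) = conv f g A.
Proof.
move=> fr gr; rewrite /conv qconj_sum; apply: eq_bigr => V sV.
by rewrite qconjM fr // gr ?subsetDl // [RHS]qconj_fixedC // fr.
Qed.

Lemma convNl f g A : conv (fun V => - f V) g A = - conv f g A.
Proof. by rewrite /conv -sumrN; apply: eq_bigr => V _; rewrite mulNr. Qed.

Lemma big_subsetU1 (E : {set T} -> H) j A : j \notin A ->
  \sum_(V : {set _} | V \subset j |: A) E V =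
  \sum_(V : {set _} | V \subset A) E (j |: V) + \sum_(V : {set _} | V \subset A) E V.
Proof.
move=> jA; rewrite (bigID (fun V : {set T} => j \in V)) /=; congr (_ + _).
  rewrite (reindex_onto (fun V => j |: V) (fun V => V :\ j)) /=; last first.
    by move=> V /andP[_ jV]; rewrite setD1K.
  apply: eq_bigl => V; rewrite setU11 andbT.
  apply/andP/idP => [[sV /eqP <-]|sV].
    rewrite subDset (subset_trans _ sV) //.
  by rewrite setUS //; split=> //; apply/eqP/setU1K; apply: contra jA => /(subsetP sV).
apply: eq_bigl => V; apply/andP/idP => [[sV jV]|sV].
  apply/subsetP => x xV; have:= subsetP sV _ xV; rewrite !inE => /orP[/eqP e|//].
  by rewrite -e xV in jV.
split; first exact: subset_trans sV (subsetUr _ _).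
by apply: contra jA => /(subsetP sV).
Qed.

(** A Leibniz rule: the new element [j] falls into either the left or the right block. *)
Lemma conv_setU1 f g j A : j \notin A ->
  conv f g (j |: A) =
  conv (fun V => f (j |: V)) g A + conv f (fun V => g (j |: V)) A.
Proof.
move=> jA; rewrite /conv big_subsetU1 //; congr (_ + _); apply: eq_bigr => V sV.
  congr (_ * g _); apply/setP => x; rewrite !inE.
  by case: eqP => [->|]; rewrite ?(negPf jA) ?andbF.
congr (_ * g _); apply/setP => x; rewrite !inE.
by case: eqP => [->|//]; rewrite andbT; apply: contra jA => /(subsetP sV).
Qed.

End SubsetConvolution.

(** * Signed path sums and abstract cofactors of a Hermitian matrix *)

Section Paths.
Variables (m : nat) (R : rcfType) (M : 'M[quat R]_m).
Local Notation H := (quat R).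
Implicit Types (U V : {set 'I_m}) (c i j k : 'I_m).

(** The fuel [n] makes the recursion structural. Started at [#|U|.+1], it never reaches the default
    0. *)
Fixpoint path_sum_rec n U c i : H :=
  if n is n'.+1 then
    (if U == set0 then M c i else 0)
    - \sum_(k in U) M c k * path_sum_rec n' (U :\ k) k i
  else 0.

(* The signed sum, over all orderings k_1, ..., k_l of U, of the products
   (-1)^l M c k_1 * M k_1 k_2 * ... * M k_l i. *)
Definition path_sum c i U : H := path_sum_rec #|U|.+1 U c i.

Lemma path_sumE c i U :
  path_sum c i U = (if U == set0 then M c i else 0)
                   - \sum_(k in U) M c k * path_sum k i (U :\ k).
Proof.
rewrite {1}/path_sum /=; congr (_ - _); apply: eq_bigr => k kU.
by rewrite /path_sum (cardsD1 k U) kU.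
Qed.

(** Peels off the last step of a path instead of the first: the sums over the first and the last
    intermediate vertex can be exchanged. *)
Lemma path_sum_recr c i U :
  path_sum c i U = (if U == set0 then M c i else 0)
                   - \sum_(k in U) path_sum c k (U :\ k) * M k i.
Proof.
have [n] := ubnP #|U|; elim: n => // n IH in U c i * => leU.
rewrite path_sumE; congr (_ - _).
have swap : \sum_(k in U) \sum_(l in U :\ k) M c k * (path_sum k l (U :\ k :\ l) * M l i)
  = \sum_(l in U) \sum_(k in U :\ l) M c k * (path_sum k l (U :\ l :\ k) * M l i).
  rewrite (exchange_big_dep (mem U)) /=; last by move=> k l _; rewrite !inE => /andP[].
  apply: eq_bigr => l lU; apply: eq_big => [k|k _].
    by rewrite !inE lU andbT eq_sym andbC.
  by rewrite !setDDl setUC.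
transitivity (\sum_(k in U) (M c k * (if U :\ k == set0 then M k i else 0)
    - \sum_(l in U :\ k) M c k * (path_sum k l (U :\ k :\ l) * M l i))).
  apply: eq_bigr => k kU; rewrite IH; last by rewrite (cardsD1 k) kU in leU.
  by rewrite mulrBr mulr_sumr.
rewrite big_split /= sumrN swap -sumrN -big_split /=; apply: eq_bigr => l lU.
rewrite [in RHS]path_sumE mulrBl; congr (_ - _).
  by case: ifP; rewrite ?mulr0 ?mul0r.
by rewrite mulr_suml; apply: eq_bigr => k _; rewrite mulrA.
Qed.

Lemma conv_path_sum c i (g : {set 'I_m} -> H) U :
  conv (path_sum c i) g U =
  M c i * g U - \sum_(k in U) M c k * conv (path_sum k i) g (U :\ k).
Proof.
rewrite /conv.
under eq_bigr => V _ do rewrite path_sumE mulrBl.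
rewrite big_split /= sumrN; congr (_ - _).
  rewrite (bigD1 set0) ?sub0set //= eqxx setD0 big1 ?addr0 // => V /andP[_ /negPf->].
  by rewrite mul0r.
under [LHS]eq_bigr => V _ do rewrite mulr_suml.
rewrite (exchange_big_dep (mem U)) /=; last by move=> V k sV /(subsetP sV).
apply: eq_bigr => k kU; rewrite mulr_sumr /=.
rewrite [LHS](reindex_onto (fun V => k |: V) (fun V => V :\ k)) /=; last first.
  by move=> V /andP[_ kV]; rewrite setD1K.
apply: eq_big => [V|V].
  rewrite setU11 andbT subUset sub1set kU subsetD1; congr andb.
  apply/eqP/idP => [<-|kV]; first by rewrite !inE eqxx.
  by rewrite setU1K.
rewrite setU11 andbT => /andP[_ /eqP->].
by rewrite mulrA setDDl.
Qed.

(** Each path is cut at its visit to [j]. The sign appears because [j] counts as an intermediate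
    vertex on the left only. *)
Lemma path_sum_split c i j U : j \notin U ->
  path_sum c i (j |: U) = - conv (path_sum c j) (path_sum j i) U.
Proof.
have [n] := ubnP #|U|; elim: n => // n IH in U c * => leU jU.
rewrite path_sumE ifF; last by apply/negP => /eqP/setP/(_ j); rewrite !inE eqxx.
rewrite sub0r; congr (- _).
rewrite big_setU1 //= setU1K // conv_path_sum -sumrN; congr (_ + _).
apply: eq_bigr => k kU; rewrite -mulrN -IH.
- congr (_ * path_sum _ _ _); apply/setP => x; rewrite !inE.
  by case: (x =P j) => [->|]; rewrite ?orbF //= ?andbT; apply: contra jU => /eqP->.
- by rewrite (cardsD1 k) kU in leU.
- by rewrite !inE negb_and jU orbT.
Qed.

Hypothesis M_herm : forall a b, M b a = qconj (M a b).

(** Conjugation reverses products, so it turns the first-step recursion into the last-step one. *)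
Lemma path_sum_conj c i U : qconj (path_sum c i U) = path_sum i c U.
Proof.
have [n] := ubnP #|U|; elim: n => // n IH in U c i * => leU.
rewrite path_sumE [RHS]path_sum_recr qconjD qconjN qconj_sum; congr (_ - _).
  by case: ifP => _; rewrite ?qconj0 -?M_herm.
apply: eq_bigr => k kU; rewrite qconjM IH -?M_herm //.
by rewrite (cardsD1 k) kU in leU.
Qed.

(** Rotation of a cycle: both sides are real, and cutting each at the other vertex gives the same
    two factors in opposite order, hence equal real parts. *)
Lemma path_sum_cyc i j U : j \notin U -> i \notin U ->
  path_sum i i (j |: U) = path_sum j j (i |: U).
Proof.
move=> jU iU; apply: qre_inj_fixed; rewrite ?path_sum_conj //.
by rewrite !path_sum_split // !qreN qre_convC.
Qed.

(** Abstract principal minors [D] and cofactors [F], later instantiated by [hdet_on] and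
    [row_cofactor]. *)
Variables (D : {set 'I_m} -> H) (F : {set 'I_m} -> 'I_m -> 'I_m -> H).
Hypothesis D0 : D set0 = 1.
Hypothesis DF : forall U, U != set0 -> exists2 i, i \in U & D U = F U i i.
Hypothesis F_rec : forall U c i, i \in U ->
  F U c i = M c i * D (U :\ i) - \sum_(k in U :\ i) M c k * F (U :\ k) k i.

(** Both sides obey the same recursion, obtained by removing the first step out of [c]. *)
Lemma cofactor_conv U c i : i \in U -> F U c i = conv (path_sum c i) D (U :\ i).
Proof.
have [n] := ubnP #|U|; elim: n => // n IH in U c * => leU iU.
rewrite F_rec // conv_path_sum; congr (_ - _); apply: eq_bigr => k.
rewrite !inE => /andP[ki kU]; rewrite IH ?inE ?iU ?(eq_sym i k) ?ki //.
  by rewrite !setDDl setUC.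
by rewrite (cardsD1 k) kU in leU.
Qed.

(* Sums over all pairs of disjoint cycles through i and through j are
   symmetric in i and j. *)
Lemma cofactor_sym U i j :
  (forall V, V \proper U -> qconj (D V) = D V) ->
  (forall V k, V \proper U -> k \in V -> F V k k = D V) ->
  i \in U -> j \in U -> F U i i = F U j j.
Proof.
move=> Dr FD iU jU; have [->//|ij] := eqVneq i j.
set W := U :\ i :\ j.
have jW : j \notin W by rewrite !inE eqxx.
have iW : i \notin W by rewrite !inE eqxx andbF.
have Ui : U :\ i = j |: W by rewrite setD1K // !inE eq_sym ij.
have Uj : U :\ j = i |: W.
  apply/setP => x; rewrite !inE.
  by case: (x =P i) => [->|]; rewrite ?ij ?iU.
(* Either the cycle through one of [i], [j] also contains the other, or the other lies in the
   remaining minor; the two cases are compared separately. *)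
rewrite !cofactor_conv // Ui Uj !conv_setU1 //; congr (_ + _).
  apply: eq_conv => // V sV; apply: path_sum_cyc.
    by apply: contra jW => /(subsetP sV).
  by apply: contra iW => /(subsetP sV).
have pr : forall k V, V \subset W -> qconj (path_sum k k V) = path_sum k k V.
  by move=> k V _; rewrite path_sum_conj.
(* In the second case the minor is expanded along the other index. This leaves closed path sums at
   both indices, which are real and so commute, and a smaller minor. *)
have Dc k k' : k' \notin W -> k' \in U -> k \in U -> k != k' -> k \notin W ->
    conv (path_sum k k) (fun V => D (k' |: V)) W
  = conv (path_sum k k) (conv (path_sum k' k') D) W.
  move=> k'W k'U kU kk' kW; apply: eq_conv => // V sV.
  have k'V : k' \notin V by apply: contra k'W => /(subsetP sV).
  rewrite -(FD _ k') ?setU11 ?cofactor_conv ?setU1K ?setU11 //.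
  apply/properP; split.
    apply/subsetP => x; rewrite !inE => /orP[/eqP->//|/(subsetP sV)].
    by rewrite !inE => /and3P[].
  exists k => //; rewrite !inE (negPf kk') /=.
  by apply: contra kW => /(subsetP sV).
rewrite Dc // Dc // 1?eq_sym // !convA.
by apply: eq_conv => // V sV; apply: convC => U' sU'; apply: pr; exact: subset_trans sU' sV.
Qed.

(** The two claims are proved together because [cofactor_sym] at [U] needs both on proper subsets.
    [DF] supplies one good index, and symmetry carries it to all others. *)
Lemma minor_fixed_and_cofactor_diag U :
  qconj (D U) = D U /\ (forall i, i \in U -> F U i i = D U).
Proof.
have [n] := ubnP #|U|; elim: n => // n IH in U * => leU.
have Dr V : V \proper U -> qconj (D V) = D V.
  by move=> /proper_card ltV; case: (IH V) => //; exact: leq_trans ltV leU.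
have FD V k : V \proper U -> k \in V -> F V k k = D V.
  by move=> /proper_card ltV; case: (IH V) => [|_]; [exact: leq_trans ltV leU|exact].
have [->|U0] := eqVneq U set0; first by split=> [|i]; rewrite ?D0 ?qconj1 ?inE.
have [i iU DE] := DF U0; split.
  rewrite DE cofactor_conv // conv_fixed // => V sV; first by rewrite path_sum_conj.
  by apply: Dr; apply: sub_proper_trans sV (properD1 iU).
by move=> j jU; rewrite DE (cofactor_sym _ FD jU iU).
Qed.

Lemma minor_fixed U : qconj (D U) = D U.
Proof. by case: (minor_fixed_and_cofactor_diag U). Qed.

Lemma cofactor_diag U i : i \in U -> F U i i = D U.
Proof. by case: (minor_fixed_and_cofactor_diag U) => _; apply. Qed.

(* A path from c to i through U either returns to c, or leaves a cycle
   through c in the complementary minor; the two kinds cancel. *)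
Lemma cofactor_offdiag U c i : i \in U -> c \in U -> c != i -> F U c i = 0.
Proof.
move=> iU cU ci; set W := U :\ i :\ c.
have cW : c \notin W by rewrite !inE eqxx.
have Ui : U :\ i = c |: W by rewrite setD1K // !inE ci.
rewrite cofactor_conv // Ui conv_setU1 //.
have -> : conv (fun V => path_sum c i (c |: V)) D W
        = - conv (conv (path_sum c c) (path_sum c i)) D W.
  rewrite -convNl; apply: eq_conv => // V sV; apply: path_sum_split.
  by apply: contra cW => /(subsetP sV).
have -> : conv (path_sum c i) (fun V => D (c |: V)) W
        = conv (path_sum c i) (conv (path_sum c c) D) W.
  apply: eq_conv => // V sV.
  have cV : c \notin V by apply: contra cW => /(subsetP sV).
  by rewrite -(cofactor_diag (setU11 c V)) cofactor_conv ?setU11 // setU1K.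
rewrite convA addrC; apply/eqP; rewrite subr_eq0; apply/eqP.
apply: eq_conv => // V sV; rewrite -convC // => V' _.
by rewrite path_sum_conj.
Qed.

End Paths.

(** * Determinants as sums over permutations of a subset *)

Section PermutationCycles.
Variables (R : rcfType) (m : nat).
Local Notation H := (quat R).
Implicit Types (N : 'M[H]_m) (s t : 'S_m) (a b i k : 'I_m) (A : {set 'I_m}).

Lemma porbitPiter s a b : reflect (exists n, b = iter n s a) (b \in porbit s a).
Proof.
apply: (iffP (porbitP s a b)) => [[n ->]|[n ->]]; exists n; by rewrite permX.
Qed.

Lemma iter_porbit_mem s a n : iter n s a \in porbit s a.
Proof. by apply/porbitPiter; exists n. Qed.

Lemma porbit_fix s a : s a = a -> porbit s a = [set a].
Proof.
move=> sa; apply/setP => b; rewrite inE; apply/porbitPiter/eqP => [[n ->]|->].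
  by elim: n => //= n ->.
by exists 0%N.
Qed.

Lemma eq_iter_porbit s t a : {in porbit t a, s =1 t} ->
  forall n, iter n s a = iter n t a.
Proof.
by move=> st; elim=> //= n ->; rewrite st // iter_porbit_mem.
Qed.

Lemma eq_porbit_in s t a : {in porbit t a, s =1 t} -> porbit s a = porbit t a.
Proof.
move=> /eq_iter_porbit st; apply/setP => b.
by apply/porbitPiter/porbitPiter => -[n ->]; exists n.
Qed.

Lemma eq_cycle_min s t a : {in porbit t a, s =1 t} ->
  cycle_min s a = cycle_min t a.
Proof. by move=> st; rewrite /cycle_min (eq_porbit_in st). Qed.

Lemma eq_cycle_prod N N' s t a : {in porbit t a, s =1 t} ->
  {in porbit t a, forall b, N b =1 N' b} -> cycle_prod N s a = cycle_prod N' t a.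
Proof.
move=> st eN; rewrite /cycle_prod (eq_porbit_in st); apply: eq_bigr => j _.
by rewrite !(eq_iter_porbit st) eN // iter_porbit_mem.
Qed.

Lemma cycle_prod_fix N s a : s a = a -> cycle_prod N s a = N a a.
Proof.
move=> sa; rewrite /cycle_prod porbit_fix // cards1 big_ord1 /=.
by rewrite sa.
Qed.

Section SplitFirstStep.
Variables (i k : 'I_m) (t : 'S_m).
Hypotheses (ik : i != k) (tk : t k = k).
(** The permutation [s] inserts the fixed point [k] of [t] into the cycle of [i], as i -> k -> t
    i. *)
Let s := (tperm i k * t)%g.

Lemma step_first : s i = k.
Proof. by rewrite permM tpermL. Qed.

Lemma step_second : s k = t i.
Proof. by rewrite permM tpermR. Qed.

Lemma step_other a : a != i -> a != k -> s a = t a.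
Proof. by move=> ai ak; rewrite permM tpermD // eq_sym. Qed.

Lemma porbit_fixed_notin : k \notin porbit t i.
Proof. by rewrite porbit_sym porbit_fix // inE. Qed.

(** Before the orbit of [i] closes up, the iterates of [t] avoid both [i] and [k], where alone [s]
    and [t] differ; the detour through [k] delays [s] by one step. *)
Lemma iter_step n : (0 < n <= #|porbit t i|)%N -> iter n.+1 s i = iter n t i.
Proof.
elim: n => // -[_ _|n IH /andP[_ ltn]]; first by rewrite /= step_first step_second.
rewrite iterS IH ?(ltnW ltn) // step_other //.
  have := uniq_traject_porbit t i.
  case E: #|porbit t i| ltn => [//|p] ltn; rewrite /= => /andP[+ _].
  apply: contraNneq => e; apply/trajectP; exists n; first by rewrite -ltnS.
  by rewrite -iterSr /= e.
by apply: contraNneq porbit_fixed_notin => <-; exact: iter_porbit_mem.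
Qed.

Lemma porbit_step : porbit s i = k |: porbit t i.
Proof.
apply/setP => b; apply/porbitPiter/idP => [[n ->]|].
  elim: n => [|n IH] /=; first by rewrite !inE porbit_id orbT.
  move: IH; move: (iter n s i) => c; rewrite !inE => /orP[/eqP->|ct].
    by rewrite step_second (iter_porbit_mem t i 1) orbT.
  have [->|ci] := eqVneq c i; first by rewrite step_first eqxx.
  rewrite step_other //.
    by case/porbitPiter: ct => l ->; rewrite (iter_porbit_mem t i l.+1) orbT.
  by apply: contraNneq porbit_fixed_notin => <-.
rewrite !inE => /orP[/eqP->|]; first by exists 1%N; rewrite /= step_first.
rewrite porbit_traject => /trajectP[n ltn ->]; case: n ltn => [|n] ltn; first by exists 0%N.
by exists n.+2; apply/esym/iter_step; exact: ltnW.
Qed.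

(** Once [k] is deleted, the step leaving [i] must read the entry that left [k]; hence row [i] of
    [N'] is row [k] of [N]. *)
Lemma cycle_prod_step N N' : {in porbit t i, forall a, a != i -> N a =1 N' a} ->
  N k =1 N' i -> cycle_prod N s i = N i k * cycle_prod N' t i.
Proof.
move=> eN eNk; rewrite /cycle_prod porbit_step cardsU1 porbit_fixed_notin add1n.
have p0 : (0 < #|porbit t i|)%N by rewrite lt0n card_porbit_neq0.
have uq := uniq_traject_porbit t i.
have stp := iter_step.
case E: #|porbit t i| p0 stp uq => [//|p] _ stp uq.
rewrite !big_ord_recl /= step_first step_second eNk; congr (_ * (_ * _)).
apply: eq_bigr => j _ /=.
have := stp j.+1; have := stp j.+2; rewrite /= !ltnS => -> //.
move=> -> //; last exact: ltnW.
apply: eN; first exact: (iter_porbit_mem t i j.+1).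
move: uq => /= /andP[+ _]; apply: contraNneq => e.
by apply/trajectP; exists j => //; rewrite -iterSr /= e.
Qed.

Lemma notin_porbit_step a : a \notin porbit s i -> {in porbit t a, s =1 t}.
Proof.
rewrite porbit_step !inE negb_or => /andP[ak at_] b bt.
apply: step_other.
  by apply: contraNneq at_ => bi; rewrite porbit_sym -bi.
apply: contraNneq ak => bk; move: bt; rewrite porbit_sym bk porbit_fix //.
by rewrite inE.
Qed.

End SplitFirstStep.

(** Row determinant of a principal submatrix, written with permutations of the full index type
    supported on [A], so that different subsets can be compared without reindexing. *)
Definition rdet_on A i N : H :=
  \sum_(s : 'S_m | perm_on A s) (- 1) ^+ s *
    (cycle_prod N s i *
     \prod_(a in A | (a \notin porbit s i) && cycle_min s a) cycle_prod N s a).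

Definition hdet_on A N : H :=
  \sum_(s : 'S_m | perm_on A s) (- 1) ^+ s *
    \prod_(a in A | cycle_min s a) cycle_prod N s a.

Lemma perm_on_fix A s i : perm_on A s && (s i == i) = perm_on (A :\ i) s.
Proof.
apply/andP/idP => [[/subsetP sA /eqP si]|/subsetP sA].
  apply/subsetP => a; rewrite !inE => sa; rewrite (sA a sa) andbT.
  by apply: contraNneq sa => ->; rewrite si.
split; first by apply/subsetP => a /sA; rewrite !inE => /andP[].
by apply: contraTT isT => si; have := sA i si; rewrite !inE eqxx.
Qed.

Lemma porbit_perm_on A s a : perm_on A s -> a \in A -> porbit s a \subset A.
Proof.
move=> sA aA; apply/subsetP => b /porbitPiter[n ->].
by elim: n => //= n IH; rewrite perm_closed.
Qed.

Lemma mulr_signCA (e : bool) (x y : H) :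
  (- 1) ^+ e * (x * y) = x * ((- 1) ^+ e * y).
Proof. by rewrite !mulrA commr_sign. Qed.

(** Permutations are sorted by the image of [i]. Fixing [i] leaves the complementary minor; sending
    [i] to [k] leaves, after deletion of that step, a row determinant on [A :\ k] with opposite
    sign. *)
Lemma rdet_on_row_repl (M : 'M[H]_m) A i (z : 'rV[H]_m) : i \in A ->
  rdet_on A i (row_repl M i z) =
  z 0 i * hdet_on (A :\ i) M
  - \sum_(k in A :\ i) z 0 k * rdet_on (A :\ k) i (row_repl M i (row k M)).
Proof.
move=> iA; rewrite /rdet_on; set N := row_repl M i z.
have Ni k : N i k = z 0 k by rewrite mxE eqxx.
rewrite (partition_big (fun s : 'S_m => s i) (mem A)) /=; last first.
  by move=> s sA; rewrite perm_closed.
rewrite (big_setD1 i) //=; congr (_ + _).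
  rewrite /hdet_on mulr_sumr; apply: eq_big => [s|s]; first exact: perm_on_fix.
  move=> /andP[sA /eqP si]; rewrite cycle_prod_fix // porbit_fix // Ni.
  rewrite mulr_signCA; congr (_ * (_ * _)).
  apply: eq_big => [a|a].
    by rewrite !inE andbCA andbA.
  rewrite inE => /and3P[aA ai _]; apply: eq_cycle_prod => // b ba c.
  rewrite mxE ifF //; apply/negbTE; apply: contraNneq ai => bi.
  by move: ba; rewrite bi porbit_sym porbit_fix // inE.
rewrite -sumrN; apply: eq_bigr => k; rewrite !inE => /andP[ki kA].
have ik : i != k by rewrite eq_sym.
(* Writing the permutation as [tperm i k * t], the condition that [i] goes to [k] says that [t]
   fixes [k]. *)
rewrite mulr_sumr -sumrN (reindex_inj (mulgI (tperm i k))) /=.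
have tA : perm_on A (tperm i k).
  apply/subsetP => a; rewrite inE; case: tpermP => [->|->|] //.
  by rewrite eqxx.
apply: eq_big => [t|t].
  rewrite permM tpermL -perm_on_fix; congr (_ && _).
  by apply/idP/idP => [h|]; [rewrite -(tpermKg i k t)|]; apply: perm_onM.
rewrite permM tpermL => /andP[h /eqP tk]; set s := (_ * t)%g.
rewrite (@cycle_prod_step _ _ _ ik tk N (row_repl M i (row k M))); last 2 first.
- by move=> a _ ai b; rewrite !mxE (negPf ai).
- by move=> b; rewrite !mxE eqxx (negPf ki).
rewrite Ni -/s odd_mul_tperm ik signr_addb expr1 !mulN1r mulNr; congr (- _).
rewrite -(mulrA (z 0 k)) [LHS]mulr_signCA; congr (_ * (_ * (_ * _))).
apply: eq_big => [a|a].
  rewrite porbit_step // !inE negb_or -!andbA andbCA.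
  case: (boolP (a == k)) => //= ak; congr (_ && _).
  case: (boolP (a \in porbit t i)) => //= at_.
  apply: eq_cycle_min; apply: notin_porbit_step => //.
  by rewrite porbit_step // !inE negb_or ak.
move=> /and3P[aA as_ _]; apply: eq_cycle_prod; first exact: notin_porbit_step.
move=> b ba c; rewrite !mxE; case: eqP => // bi; case/negP: as_.
by rewrite porbit_step // !inE porbit_sym -bi ba orbT.
Qed.

End PermutationCycles.

(** * Noncommutative products in increasing order of the indices *)

Section OrderedProducts.
Variables (R : rcfType) (m : nat).
Local Notation H := (quat R).

(** The factors do not commute, so [E a0] can be pulled out in front only because [a0] is the first
    index of the increasing list satisfying [P]. *)
Lemma big_sorted_first (r : seq 'I_m) (P : pred 'I_m) (E : 'I_m -> H) a0 :
  sorted ltn (map val r) -> a0 \in r -> P a0 ->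
  (forall a, P a -> (a0 <= a)%N) ->
  \prod_(a <- r | P a) E a = E a0 * \prod_(a <- r | P a && (a != a0)) E a.
Proof.
move=> + + Pa0 min; elim: r => //= a r IH sr.
have /allP ar := order_path_min ltn_trans sr.
rewrite !inE !big_cons => /orP[/eqP e|a0r].
  rewrite -{a}e in sr ar *; rewrite Pa0 eqxx /=; congr (_ * _); rewrite big_seq_cond [RHS]big_seq_cond.
  apply: eq_bigl => b; case: (boolP (b \in r)) => //= br.
  have ab : (a0 < b)%N := ar _ (map_f val br).
  by have -> : b != a0; [apply: contraTneq ab => ->; rewrite ltnn|rewrite andbT].
have lt_a : (a < a0)%N by apply: ar; apply: map_f.
have /negPf-> : ~~ P a by apply: contraL lt_a => /min; rewrite -leqNgt.
by rewrite /= IH // (path_sorted sr).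
Qed.

Lemma sorted_enum_ord (A : {set 'I_m}) : sorted ltn (map val (enum A)).
Proof.
rewrite {1}/enum_mem -enumT sorted_map.
apply: sorted_filter; first by move=> x y z; apply: ltn_trans.
by rewrite -sorted_map val_enum_ord iota_ltn_sorted.
Qed.

Lemma index_enumE (T : finType) : index_enum T = enum T.
Proof. by rewrite enumT; unlock index_enum. Qed.

Lemma big_ord_first (P : pred 'I_m) (E : 'I_m -> H) a0 : P a0 ->
  (forall a, P a -> (a0 <= a)%N) ->
  \prod_(a < m | P a) E a = E a0 * \prod_(a < m | P a && (a != a0)) E a.
Proof.
move=> Pa0 min; rewrite index_enumE; apply: big_sorted_first => //.
  by rewrite val_enum_ord iota_ltn_sorted.
by rewrite mem_enum.
Qed.

Lemma enum_set_map (A : {set 'I_m}) : enum A = map enum_val (enum 'I_#|A|).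
Proof.
have sz : size (enum A) = size (map (@enum_val _ (mem A)) (enum 'I_#|A|)).
  by rewrite size_map size_enum_ord cardE.
have [A0|/card_gt0P[x0 _]] := posnP #|A|.
  apply/eqP; rewrite (size0nil (s := enum A)) -?cardE //.
  by rewrite eq_sym -size_eq0 -sz -cardE A0.
apply: (eq_from_nth (x0 := x0) sz) => j; rewrite -cardE => lj.
rewrite (nth_map (Ordinal lj)) ?size_enum_ord // (enum_val_nth x0).
by rewrite nth_enum_ord.
Qed.

Lemma prod_enum_val (A : {set 'I_m}) (P : pred 'I_m) (E : 'I_m -> H) :
  \prod_(x in A | P x) E x =
  \prod_(a < #|A| | P (enum_val a)) E (enum_val a).
Proof.
rewrite [in RHS]index_enumE -(big_map _ P) -enum_set_map.
by rewrite [in RHS]/enum_mem big_filter_cond index_enumE enumT.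
Qed.

End OrderedProducts.

(** * Determinants of principal submatrices as determinants on subsets *)

Section SubsetDeterminants.
Variables (R : rcfType) (m : nat).
Local Notation H := (quat R).
Implicit Types (N : 'M[H]_m) (A : {set 'I_m}).

Lemma hdet_on0 N : hdet_on set0 N = 1.
Proof.
rewrite /hdet_on (big_pred1 (1%g : 'S_m)) => [|s].
  by rewrite odd_perm1 mul1r big_pred0 // => a; rewrite inE.
apply/idP/eqP => [s0|->]; last exact: perm_on1.
by apply: perm_on_id s0 _; rewrite cards0.
Qed.

(** The witness is the least element of [A]: its cycle comes first in the increasing order of minima
    anyway. *)
Lemma hdet_on_rdet_on N A : A != set0 ->
  exists2 i, i \in A & hdet_on A N = rdet_on A i N.
Proof.
case/set0Pn=> b bA; pose i := [arg min_(j < b in A) val j].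
have [iA imin] : i \in A /\ (forall a, a \in A -> (i <= a)%N).
  by rewrite /i; case: arg_minnP.
exists i => //; apply: eq_bigr => s sA; congr (_ * _).
have sub := subsetP (porbit_perm_on sA iA).
have cm : cycle_min s i by apply/forall_inP => a /sub; apply: imin.
rewrite (@big_ord_first _ _ _ _ i) ?iA //; last by move=> a /andP[/imin].
congr (_ * _); apply: eq_bigl => a; rewrite -andbA; congr (_ && _).
rewrite andbC; case: (boolP (cycle_min s a)) => ca; rewrite ?andbF // !andbT.
congr (~~ _); apply/eqP/idP => [->|ai]; first exact: porbit_id.
have /forall_inP ca' := ca; apply/val_inj/eqP; rewrite eqn_leq /=.
by rewrite ca' 1?porbit_sym // imin // sub.
Qed.

Lemma porbits_sign n (s : 'S_n) :
  (- 1) ^+ (n - #|porbits s|) = (- 1) ^+ s :> H.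
Proof.
rewrite -signr_odd oddB ?/odd_perm ?card_ord //.
by apply: leq_trans (leq_imset_card _ _) _; rewrite card_ord.
Qed.

Lemma perm_onT (s : 'S_m) : perm_on setT s.
Proof. by apply/subsetP => a; rewrite inE. Qed.

Lemma rdet_onT N i : rdet i N = rdet_on setT i N.
Proof.
apply: eq_big => [s|s _]; first by rewrite perm_onT.
by rewrite porbits_sign; congr (_ * (_ * _)); apply: eq_bigl => a; rewrite inE.
Qed.

Lemma hdet_onT N : hdet N = hdet_on setT N.
Proof.
apply: eq_big => [s|s _]; first by rewrite perm_onT.
by rewrite porbits_sign; congr (_ * _); apply: eq_bigl => a; rewrite inE.
Qed.

Section Transfer.
Variable A : {set 'I_m}.
Local Notation f := (@enum_val _ (mem A)).
Implicit Types (t : 'S_#|A|) (a b : 'I_#|A|).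

Lemma enum_val_leq a b : (f a <= f b)%N = (a <= b)%N.
Proof.
have x0 := f a.
have lt_f (c d : 'I_#|A|) : (c < d)%N -> (f c < f d)%N.
  move=> cd; rewrite !(enum_val_nth x0) -!(nth_map _ 0%N val) -?cardE //.
  apply: (sorted_ltn_nth ltn_trans) => //; rewrite ?inE ?size_map -?cardE //.
  exact: sorted_enum_ord.
case: (ltngtP a b) => [/lt_f/ltnW->|/lt_f|/val_inj->] //; last by rewrite leqnn.
by rewrite ltnNge => /negPf.
Qed.

Definition ext_fun t (x : 'I_m) := if [pick a | f a == x] is Some a then f (t a) else x.

Lemma ext_funE t a : ext_fun t (f a) = f (t a).
Proof.
rewrite /ext_fun; case: pickP => [b /eqP/enum_val_inj->//|/(_ a)].
by rewrite eqxx.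
Qed.

Lemma ext_fun_out t x : x \notin A -> ext_fun t x = x.
Proof.
by rewrite /ext_fun; case: pickP => // a /eqP <-; rewrite enum_valP.
Qed.

Lemma enum_val_ex x : x \in A -> exists a, x = f a.
Proof. by move=> xA; exists (enum_rank_in xA x); rewrite enum_rankK_in. Qed.

Lemma ext_fun_inj t : injective (ext_fun t).
Proof.
move=> x y; case: (boolP (x \in A)) => [/enum_val_ex[a ->]|xA];
  case: (boolP (y \in A)) => [/enum_val_ex[b ->]|yA];
  rewrite ?ext_funE ?(ext_fun_out _ xA) ?(ext_fun_out _ yA) //.
- by move=> /enum_val_inj/perm_inj->.
- by move=> e; rewrite -e enum_valP in yA.
- by move=> e; rewrite e enum_valP in xA.
Qed.

Definition perm_ext t : 'S_m := perm (@ext_fun_inj t).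

Lemma perm_extE t a : perm_ext t (f a) = f (t a).
Proof. by rewrite permE ext_funE. Qed.

Lemma perm_ext_out t x : x \notin A -> perm_ext t x = x.
Proof. by move=> xA; rewrite permE ext_fun_out. Qed.

Lemma perm_ext_on t : perm_on A (perm_ext t).
Proof.
by apply/subsetP => x; rewrite inE; apply: contraR => /perm_ext_out->.
Qed.

Lemma perm_ext_inj : injective perm_ext.
Proof.
move=> t u e; apply/permP => a; apply: enum_val_inj.
by rewrite -!perm_extE e.
Qed.

(** Extension by the identity sends transpositions to transpositions and respects products. *)
Lemma odd_perm_ext t : odd_perm (perm_ext t) = odd_perm t.
Proof.
have [ts -> _] := prod_tpermP t; elim: ts => [|[a b] ts IH].
  rewrite big_nil odd_perm1 (_ : perm_ext 1 = 1)%g ?odd_perm1 //.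
  apply/permP => x; rewrite perm1.
  case: (boolP (x \in A)) => [/enum_val_ex[c ->]|/perm_ext_out//].
  by rewrite perm_extE perm1.
rewrite big_cons /= odd_mul_tperm -IH -(inj_eq (@enum_val_inj _ (mem A))) -odd_mul_tperm.
congr (odd_perm _); apply/permP => x; rewrite permM.
case: (boolP (x \in A)) => [/enum_val_ex[c ->]|xA].
  by rewrite -(inj_tperm _ _ _ (@enum_val_inj _ (mem A))) !perm_extE permM.
by rewrite !perm_ext_out // tpermD ?perm_ext_out //;
   apply: contraNneq xA => <-; apply: enum_valP.
Qed.

Lemma iter_perm_ext t a n : iter n (perm_ext t) (f a) = f (iter n t a).
Proof. by elim: n => //= n ->; rewrite perm_extE. Qed.

Lemma porbit_perm_ext t a : porbit (perm_ext t) (f a) = f @: porbit t a.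
Proof.
apply/setP => x; apply/porbitPiter/imsetP => [[n ->]|[b /porbitPiter[n ->] ->]].
  by exists (iter n t a); rewrite ?iter_porbit_mem // iter_perm_ext.
by exists n; rewrite iter_perm_ext.
Qed.

Lemma cycle_prod_perm_ext N t a :
  cycle_prod N (perm_ext t) (f a) = cycle_prod (psubmx N A) t a.
Proof.
rewrite /cycle_prod porbit_perm_ext card_imset; last exact: enum_val_inj.
by apply: eq_bigr => n _; rewrite !iter_perm_ext mxE.
Qed.

Lemma cycle_min_perm_ext t a : cycle_min (perm_ext t) (f a) = cycle_min t a.
Proof.
rewrite /cycle_min porbit_perm_ext; apply/forall_inP/forall_inP => h b.
  by move=> bt; rewrite -enum_val_leq; apply: h; apply: imset_f.
by case/imsetP=> c ct ->; rewrite enum_val_leq h.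
Qed.

(** Surjectivity of [perm_ext] follows by counting, as both sides have [#|A|] factorial elements. *)
Lemma big_perm_on (E : 'S_m -> H) :
  \sum_(s | perm_on A s) E s = \sum_(t : 'S_#|A|) E (perm_ext t).
Proof.
have ES : perm_ext @: setT = [set s | perm_on A s].
  apply/eqP; rewrite eqEcard; apply/andP; split.
    by apply/subsetP => _ /imsetP[t _ ->]; rewrite inE perm_ext_on.
  by rewrite card_imset ?cardsT ?card_Sn ?cardsE ?card_perm //; exact: perm_ext_inj.
transitivity (\sum_(s in [set s | perm_on A s]) E s).
  by apply: eq_bigl => s; rewrite inE.
rewrite -ES big_imset /=; last by move=> t u _ _; apply: perm_ext_inj.
by apply: eq_bigl => t; rewrite inE.
Qed.

Lemma hdet_psubmx N : hdet (psubmx N A) = hdet_on A N.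
Proof.
rewrite /hdet_on big_perm_on; apply: eq_bigr => t _.
rewrite porbits_sign odd_perm_ext; congr (_ * _).
rewrite prod_enum_val; apply: eq_big => [a|a _].
  by rewrite cycle_min_perm_ext.
by rewrite cycle_prod_perm_ext.
Qed.

Lemma rdet_psubmx N a : rdet a (psubmx N A) = rdet_on A (f a) N.
Proof.
rewrite /rdet_on big_perm_on; apply: eq_bigr => t _.
rewrite porbits_sign odd_perm_ext cycle_prod_perm_ext; congr (_ * (_ * _)).
rewrite prod_enum_val; apply: eq_big => [b|b _].
  by rewrite cycle_min_perm_ext porbit_perm_ext mem_imset //; exact: enum_val_inj.
by rewrite cycle_prod_perm_ext.
Qed.

Lemma rdet_subE N i : i \in A -> rdet_sub i N A = rdet_on A i N.
Proof.
move=> iA; have lti : (index i (enum A) < #|A|)%N by rewrite cardE index_mem mem_enum.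
rewrite /rdet_sub /rdet_pos insubT rdet_psubmx; congr (rdet_on _ _ _).
by rewrite (enum_val_nth i) /= nth_index // mem_enum.
Qed.

End Transfer.
End SubsetDeterminants.

(** * Hermitian and Gram matrices *)

Section HermitianDeterminants.
Variables (R : rcfType) (m : nat) (M : 'M[quat R]_m).
Local Notation H := (quat R).
Implicit Types (U : {set 'I_m}) (c i j k : 'I_m) (u z : 'rV[H]_m).
Hypothesis M_herm : forall a b, M b a = qconj (M a b).

Definition row_cofactor U c i : H := rdet_on U i (row_repl M i (row c M)).

Lemma row_cofactor_self U i : row_cofactor U i i = rdet_on U i M.
Proof.
rewrite /row_cofactor; congr rdet_on; apply/matrixP => a b.
by rewrite !mxE; case: eqP => [->|].
Qed.

Lemma row_cofactor_rec U c i : i \in U ->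
  row_cofactor U c i = M c i * hdet_on (U :\ i) M
    - \sum_(k in U :\ i) M c k * row_cofactor (U :\ k) k i.
Proof.
move=> iU; rewrite /row_cofactor rdet_on_row_repl // mxE; congr (_ - _).
by apply: eq_bigr => k _; rewrite mxE.
Qed.

Let hdet_on_ex U : U != set0 ->
  exists2 i, i \in U & hdet_on U M = row_cofactor U i i.
Proof.
by case/(hdet_on_rdet_on M) => i iU ->; exists i; rewrite ?row_cofactor_self.
Qed.

Lemma hdet_on_fixed U : qconj (hdet_on U M) = hdet_on U M.
Proof.
exact: (minor_fixed M_herm (hdet_on0 M) hdet_on_ex row_cofactor_rec).
Qed.

Lemma row_cofactor_diag U i : i \in U -> row_cofactor U i i = hdet_on U M.
Proof.
exact: (cofactor_diag M_herm (hdet_on0 M) hdet_on_ex row_cofactor_rec).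
Qed.

Lemma row_cofactor_offdiag U c i :
  i \in U -> c \in U -> c != i -> row_cofactor U c i = 0.
Proof.
exact: (cofactor_offdiag M_herm (hdet_on0 M) hdet_on_ex row_cofactor_rec).
Qed.

(** The coefficients of the row determinant as a left-linear form in the replaced row; they stand on
    the right, hence a column. *)
Definition cofactor_col U i : 'cV[H]_m :=
  \col_k (if k \in U then
            if k == i then hdet_on (U :\ i) M else - row_cofactor (U :\ k) k i
          else 0).

Lemma cofactor_colE U i z : i \in U ->
  rdet_on U i (row_repl M i z) = (z *m cofactor_col U i) 0 0.
Proof.
move=> iU; rewrite rdet_on_row_repl // [RHS]mxE [RHS](bigID (mem U)) /=.
rewrite [X in _ = _ + X]big1 ?addr0; last by move=> k /negPf kU; rewrite mxE kU mulr0.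
rewrite [RHS](big_setD1 i) //= !mxE iU eqxx -sumrN; congr (_ + _).
apply: eq_bigr => k; rewrite !inE => /andP[/negPf ki kU].
by rewrite !mxE kU ki mulrN.
Qed.

Lemma row_cofactorE U c i : i \in U -> row_cofactor U c i = (M *m cofactor_col U i) c 0.
Proof.
by move=> iU; rewrite /row_cofactor cofactor_colE // -row_mul mxE.
Qed.

Lemma rdet_on_mulmx U i u : i \in U ->
  rdet_on U i (row_repl M i (u *m M)) = \sum_c u 0 c * row_cofactor U c i.
Proof.
move=> iU; rewrite cofactor_colE // -mulmxA mxE; apply: eq_bigr => c _.
by rewrite row_cofactorE.
Qed.

Lemma rdet_on_mulmx_out U i u : i \in U ->
  rdet_on U i (row_repl M i (u *m M)) =
  u 0 i * hdet_on U M + \sum_(c | c \notin U) u 0 c * row_cofactor U c i.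
Proof.
move=> iU; rewrite rdet_on_mulmx // (bigID (mem U)) /=; congr (_ + _).
rewrite (big_setD1 i) //= row_cofactor_diag // big1 ?addr0 // => c.
by rewrite !inE => /andP[ci cU]; rewrite row_cofactor_offdiag // mulr0.
Qed.

(* This is the coefficient of t^(m - l) in
   rdet_i (M + t I)_{i.}(u (M + t I)) = u_i det (M + t I). *)
Lemma sum_rdet_on_mulmx l i u :
  \sum_(U : {set 'I_m} | (#|U| == l) && (i \in U)) rdet_on U i (row_repl M i (u *m M))
  + \sum_(U : {set 'I_m} | (#|U| == l.+1) && (i \in U)) rdet_on U i (row_repl M i u)
  = u 0 i * \sum_(U : {set 'I_m} | #|U| == l) hdet_on U M.
Proof.
under eq_bigr => U /andP[_ iU] do rewrite rdet_on_mulmx_out //.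
under [X in _ + X]eq_bigr => U /andP[_ iU] do rewrite rdet_on_row_repl //.
rewrite !big_split /= sumrN addrACA -!mulr_sumr -mulrDr.
(* These minors belong to the [l]-sets avoiding [i], and complete those containing [i] to the full
   sum. *)
have -> : \sum_(U : {set 'I_m} | (#|U| == l.+1) && (i \in U)) hdet_on (U :\ i) M
  = \sum_(U : {set 'I_m} | (#|U| == l) && (i \notin U)) hdet_on U M.
  rewrite (reindex_onto (fun U => i |: U) (fun U => U :\ i)) /=; last first.
    by move=> U /andP[_ iU]; rewrite setD1K.
  apply: eq_big => [U|U /andP[_ /eqP->] //].
  rewrite setU11 andbT; case: (boolP (i \in U)) => iU.
    rewrite andbF; apply/negbTE; rewrite negb_and; apply/orP; right.
    by apply: contraTneq iU => <-; rewrite !inE eqxx.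
  by rewrite cardsU1 iU add1n eqSS setU1K // eqxx !andbT.
rewrite -bigID; apply/eqP; rewrite -subr_eq0 addrAC subrr add0r subr_eq0; apply/eqP.
(* The cross terms cancel: an [l]-set missing [k] corresponds to the set of size [l.+1] obtained by
   adding [k]. *)
rewrite [LHS](exchange_big_dep predT) // [RHS](exchange_big_dep predT) //=.
apply: eq_bigr => k _.
rewrite [RHS](reindex_onto (fun U => k |: U) (fun U => U :\ k)) /=; last first.
  by move=> U; rewrite !inE => /andP[_ /andP[_ kU]]; rewrite setD1K.
apply: eq_big => [U|U /andP[/andP[_ iU] kU]]; last by rewrite setU1K.
rewrite !inE eqxx /= !andbT.
case: (boolP (k \in U)) => kU /=.
  rewrite andbF; apply/esym/negbTE; rewrite negb_and; apply/orP; right.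
  by apply: contraTneq kU => <-; rewrite !inE eqxx.
rewrite cardsU1 kU add1n eqSS setU1K // eqxx !andbT.
rewrite -andbA; congr (_ && _).
have [->|ki] := eqVneq i k; first by rewrite (negPf kU).
by rewrite andbT.
Qed.

End HermitianDeterminants.

(** * Gram minors: positivity and independence of rows *)

Section GramMatrices.
Variable R : rcfType.
Local Notation H := (quat R).

Lemma qadj_mul m n p (A : 'M[H]_(m, n)) (B : 'M[H]_(n, p)) :
  qadj (A *m B) = qadj B *m qadj A.
Proof.
apply/matrixP => i j; rewrite !mxE qconj_sum; apply: eq_bigr => k _.
by rewrite !mxE qconjM.
Qed.

Lemma qadjK m n (A : 'M[H]_(m, n)) : qadj (qadj A) = A.
Proof. by apply/matrixP => i j; rewrite !mxE qconjK. Qed.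

Lemma gram_herm m n (A : 'M[H]_(m, n)) a b :
  (A *m qadj A) b a = qconj ((A *m qadj A) a b).
Proof. by rewrite -[in LHS](qadjK A) -qadj_mul qadjK mxE. Qed.

Definition sqnorm n (x : 'rV[H]_n) : R := qre ((x *m qadj x) 0 0).

Lemma sqnormE n (x : 'rV[H]_n) : sqnorm x = \sum_j qnorm2 (x 0 j).
Proof.
rewrite /sqnorm mxE qre_sum; apply: eq_bigr => j _.
by rewrite mxE qre_mulconj.
Qed.

Lemma sqnorm_ge0 n (x : 'rV[H]_n) : 0 <= sqnorm x.
Proof. by rewrite sqnormE sumr_ge0 // => j _; exact: qnorm2_ge0. Qed.

Lemma sqnorm_eq0 n (x : 'rV[H]_n) : sqnorm x = 0 -> x = 0.
Proof.
rewrite sqnormE => /eqP; rewrite psumr_eq0 => [/allP x0|j _]; last exact: qnorm2_ge0.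
apply/rowP => j; rewrite mxE; apply/eqP; rewrite -qnorm2_eq0.
by have := x0 j; rewrite mem_index_enum; apply.
Qed.

Definition row_indep m n (A : 'M[H]_(m, n)) (U : {set 'I_m}) : Prop :=
  forall v : 'rV[H]_m, (forall i, i \notin U -> v 0 i = 0) -> v *m A = 0 -> v = 0.

Variables (m n : nat) (A : 'M[H]_(m, n)).
Local Notation M := (A *m qadj A).
Local Notation D U := (hdet_on U M).
Let M_herm := gram_herm A.
Implicit Types (U : {set 'I_m}) (i k : 'I_m).

(** Cramer's rule for a relation [v] supported on [U]: the replaced row [v *m M] is zero, so each
    [v 0 i * D U] is zero. *)
Lemma hdet_on_gram_indep U : D U != 0 -> row_indep A U.
Proof.
move=> D0 v vU vA; apply/rowP => i; rewrite mxE.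
case: (boolP (i \in U)) => [iU|/vU//].
have := rdet_on_mulmx_out M_herm v iU.
rewrite [X in _ + X]big1 ?addr0; last by move=> c /vU ->; rewrite mul0r.
rewrite cofactor_colE // mulmxA vA !mul0mx mxE => e.
by rewrite -[LHS]mulr1 -(qmulV D0) mulrA -e mul0r.
Qed.

Lemma cofactor_row_out U i k : k \notin U -> qadj (cofactor_col M U i) 0 k = 0.
Proof. by move=> /negPf kU; rewrite !mxE kU qconj0. Qed.

Lemma cofactor_row_self U i : i \in U ->
  qadj (cofactor_col M U i) 0 i = D (U :\ i).
Proof. by move=> iU; rewrite !mxE iU eqxx hdet_on_fixed. Qed.

(** On the rows in [U], [M] times the cofactor column is [D U] at [i] and 0 elsewhere, so only the
    entry [D (U :\ i)] of the cofactor row contributes. *)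
Lemma sqnorm_cofactor U i : i \in U ->
  sqnorm (qadj (cofactor_col M U i) *m A) = qre (D (U :\ i)) * qre (D U).
Proof.
move=> iU; rewrite /sqnorm qadj_mul qadjK mulmxA -(mulmxA _ A) -mulmxA mxE.
rewrite (bigD1 i) //= big1 ?addr0 => [|k ki].
  rewrite cofactor_row_self // -row_cofactorE // row_cofactor_diag //.
  rewrite [D (U :\ i)]qconj_fixed ?hdet_on_fixed //.
  by rewrite [D U]qconj_fixed ?hdet_on_fixed //= !(mulr0, mul0r, subr0).
case: (boolP (k \in U)) => kU; last by rewrite cofactor_row_out // mul0r.
by rewrite -row_cofactorE // row_cofactor_offdiag // mulr0.
Qed.

Lemma cofactor_row_ker U i : i \in U -> D U = 0 ->
  qadj (cofactor_col M U i) *m A = 0.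
Proof.
by move=> iU D0; apply: sqnorm_eq0; rewrite sqnorm_cofactor // D0 mulr0.
Qed.

(** By induction the cofactor row has the nonzero entry [D (U :\ i)]; independence makes its product
    with [A] nonzero, and [sqnorm_cofactor] gives the sign of [D U]. *)
Lemma hdet_on_gram_gt0 U : row_indep A U -> 0 < qre (D U).
Proof.
have [l] := ubnP #|U|; elim: l => // l IH in U * => leU indU.
have [->|/set0Pn[i iU]] := eqVneq U set0; first by rewrite hdet_on0 ltr01.
have D'gt0 : 0 < qre (D (U :\ i)).
  apply: IH; first by rewrite (cardsD1 i) iU in leU.
  by move=> v vU; apply: indU => k kU; apply: vU; rewrite !inE (negPf kU) andbF.
rewrite -(pmulr_rgt0 _ D'gt0) -sqnorm_cofactor // lt_neqAle sqnorm_ge0 andbT eq_sym.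
apply/eqP => /sqnorm_eq0 /indU e.
have /rowP/(_ i) := e (fun k => @cofactor_row_out U i k).
by rewrite cofactor_row_self // mxE => D0; rewrite D0 ltxx in D'gt0.
Qed.

Lemma hdet_on_gram_ge0 U : 0 <= qre (D U).
Proof.
have [->//|/hdet_on_gram_indep/hdet_on_gram_gt0/ltW//] := eqVneq (D U) 0.
Qed.

End GramMatrices.

(** * Rank and least squares *)

Section Rank.
Variable R : rcfType.
Local Notation H := (quat R).

(** Gaussian elimination, one column at a time. *)
Lemma left_kernel_ex r s (X : 'M[H]_(r, s)) : (s < r)%N ->
  exists2 v : 'rV[H]_r, v != 0 & v *m X = 0.
Proof.
elim: s r X => [|s IH] [//|r] X ltsr.
  exists (const_mx 1); last by apply/rowP => -[].
  by apply/eqP => /rowP/(_ 0); rewrite !mxE => /eqP; rewrite oner_eq0.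
case: (pickP (fun i => X i 0 != 0)) => [i Xi0|X0]; last first.
  have [v v0 vX] := IH _ (col' 0 X) (ltnW ltsr); exists v => //.
  apply/rowP => j; rewrite mxE [RHS]mxE; case: (unliftP 0 j) => [j' ->|->].
    move/rowP/(_ j'): vX; rewrite !mxE => vX; rewrite -[RHS]vX.
    by apply: eq_bigr => k _; rewrite mxE.
  by rewrite big1 // => k _; have /eqP-> := negbFE (X0 k); rewrite mulr0.
(* The Schur complement of the pivot [X i 0]; below, [vi] is the coordinate that cancels column
   0. *)
pose Y : 'M[H]_(r, s) := \matrix_(a, b)
  (X (lift i a) (lift 0 b) - X (lift i a) 0 * qinv (X i 0) * X i (lift 0 b)).
have [v v0 vY] := IH _ Y ltsr.
pose vi : H := - (\sum_a v 0 a * X (lift i a) 0) * qinv (X i 0).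
pose w : 'rV[H]_r.+1 := \row_j (if unlift i j is Some a then v 0 a else vi).
have wi : w 0 i = vi by rewrite mxE unlift_none.
have wl a : w 0 (lift i a) = v 0 a by rewrite mxE liftK.
exists w.
  apply: contra v0 => /eqP w0; apply/eqP/rowP => a.
  by rewrite -wl w0 !mxE.
apply/rowP => j; rewrite mxE [RHS]mxE (bigD1_ord i) //= wi.
under eq_bigr do rewrite wl.
case: (unliftP 0 j) => [b ->|->].
  move/rowP/(_ b): vY; rewrite !mxE => vY; rewrite -[RHS]vY.
  under [RHS]eq_bigr do rewrite mxE mulrBr.
  rewrite big_split /= sumrN addrC; congr (_ + _).
  rewrite /vi !mulNr !mulr_suml; congr (- _).
  by apply: eq_bigr => a _; rewrite !mulrA.
by rewrite /vi -mulrA qmulVl // mulr1 addNr.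
Qed.

Lemma right_indep_cols_adj m n (A : 'M[H]_(m, n)) S :
  right_indep_cols A S -> row_indep (qadj A) S.
Proof.
move=> indS v vS vA; apply/rowP => j; rewrite mxE.
case: (boolP (j \in S)) => [jS|/vS//].
rewrite -[LHS]qconjK; have := indS (fun j => qconj (v 0 j)) _ j jS.
move=> ->; first by rewrite qconj0.
move=> i; move/rowP/(_ i): vA; rewrite mxE [in RHS]mxE => /(congr1 (@qconj R)).
rewrite qconj0 qconj_sum (bigID (mem S)) /= [X in _ + X]big1 ?addr0; last first.
  by move=> k /vS ->; rewrite mul0r qconj0.
by move=> {2}<-; apply: eq_bigr => k _; rewrite mxE qconjM qconjK.
Qed.

(** Row rank is at most column rank. [S] is a largest column set with nonzero Gram minor; if it were
    smaller than [U], some nonzero [v] on [U] would kill the columns in [S], and by maximality all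
    the others. *)
Lemma row_indep_cols m n (A : 'M[H]_(m, n)) U : row_indep A U ->
  exists2 S : {set 'I_n}, right_indep_cols A S & (#|U| <= #|S|)%N.
Proof.
move=> indU; pose AU : 'M[H]_(m, n) := \matrix_(i, j) (if i \in U then A i j else 0).
pose B := qadj AU; pose G := B *m qadj B.
pose S := [arg max_(S > set0 | hdet_on S G != 0) #|S|].
have [DS maxS] : hdet_on S G != 0 /\
    (forall S' : {set 'I_n}, hdet_on S' G != 0 -> (#|S'| <= #|S|)%N).
  by rewrite /S; case: arg_maxnP; rewrite ?hdet_on0 ?oner_eq0.
have AUv (v : 'rV[H]_m) : (forall i, i \notin U -> v 0 i = 0) -> v *m AU = v *m A.
  move=> vU; apply/rowP => j; rewrite !mxE; apply: eq_bigr => i _; rewrite mxE.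
  by case: ifPn => // /vU ->; rewrite !mul0r.
have indS := hdet_on_gram_indep DS.
exists S.
  move=> c cA j jS; pose v : 'rV[H]_n := \row_j (if j \in S then qconj (c j) else 0).
  have /indS/(_ _)/rowP/(_ j) : forall i, i \notin S -> v 0 i = 0.
    by move=> i /negPf iS; rewrite mxE iS.
  rewrite !mxE jS => e; rewrite -(qconjK (c j)) e ?qconj0 //.
  apply/rowP => i; rewrite !mxE.
  case: (boolP (i \in U)) => iU; last first.
    by rewrite big1 // => k _; rewrite !mxE (negPf iU) qconj0 mulr0.
  rewrite -[RHS]qconj0 -[in RHS](cA i) qconj_sum [RHS]big_mkcond /=; apply: eq_bigr => k _.
  by rewrite !mxE iU; case: ifP; rewrite ?mul0r // qconjM.
rewrite leqNgt; apply/negP => ltSU.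
have [w w0 wX] := left_kernel_ex
  (\matrix_(a < #|U|, b < #|S|) A (enum_val a) (enum_val b)) ltSU.
have [a0 _] : exists a : 'I_#|U|, true by exists (Ordinal (leq_ltn_trans (leq0n _) ltSU)).
have a0U := enum_valP a0.
pose v : 'rV[H]_m := \row_i (if i \in U then w 0 (enum_rank_in a0U i) else 0).
have vU i : i \notin U -> v 0 i = 0 by move=> /negPf iU; rewrite mxE iU.
have vw a : v 0 (enum_val a) = w 0 a by rewrite mxE enum_valP enum_valK_in.
have vS j : j \in S -> (v *m AU) 0 j = 0.
  move=> jS; rewrite AUv //.
  move/rowP/(_ (enum_rank_in jS j)): wX; rewrite !mxE => wX; rewrite -[RHS]wX.
  rewrite (bigID (mem U)) /= [X in _ + X]big1 ?addr0; last first.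
    by move=> i /vU ->; rewrite mul0r.
  rewrite big_enum_val; apply: eq_bigr => a _.
  by rewrite vw mxE enum_rankK_in.
have vAU : v *m AU = 0.
  apply/rowP => j; rewrite [RHS]mxE; case: (boolP (j \in S)) => [/vS//|jS].
  (* Maximality of [S] makes this minor vanish, so its cofactor row is a relation between column [j]
     and those in [S], with nonzero coefficient [hdet_on S G] at [j]. *)
  have D0 : hdet_on (j |: S) G = 0.
    by apply/eqP; apply: contraTT isT => /maxS; rewrite cardsU1 jS add1n ltnn.
  have jj := setU11 j S; set c := qadj (cofactor_col G (j |: S) j).
  have cB : AU *m qadj c = 0.
    rewrite -[AU]qadjK -qadj_mul (cofactor_row_ker jj D0).
    by apply/matrixP => a b; rewrite !mxE qconj0.
  have cj : c 0 j = hdet_on S G by rewrite /c cofactor_row_self // setU1K.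
  have : (v *m AU *m qadj c) 0 0 = 0 by rewrite -mulmxA cB mulmx0 mxE.
  rewrite mxE (bigD1 j) //= big1 ?addr0 => [|k kj].
    rewrite [qadj c j 0]mxE cj hdet_on_fixed => [|a b]; last exact: gram_herm.
    by move=> e; rewrite -[LHS]mulr1 -(qmulV DS) mulrA e mul0r.
  case: (boolP (k \in S)) => kS; first by rewrite vS // mul0r.
  rewrite [qadj c k 0]mxE /c cofactor_row_out ?qconj0 ?mulr0 //.
  by rewrite !inE negb_or kj.
case/eqP: w0; apply/rowP => a; rewrite -vw.
by rewrite (indU v vU) ?mxE // -AUv.
Qed.

Lemma qrank_hdet_on0 m n (A : 'M[H]_(m, n)) k (U : {set 'I_m}) : qrank_is A k ->
  (k < #|U|)%N -> hdet_on U (A *m qadj A) = 0.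
Proof.
move=> [_ maxk] ltk; apply/eqP; apply: contraTT ltk => /hdet_on_gram_indep.
by case/row_indep_cols=> S /maxk leS leU; rewrite -leqNgt (leq_trans leU).
Qed.

(** Applied to the adjoint, [row_indep_cols] turns [k] independent columns into at least [k]
    independent rows; more are excluded by the vanishing of larger minors. *)
Lemma qrank_hdet_on_gt0 m n (A : 'M[H]_(m, n)) k : qrank_is A k ->
  exists2 U : {set 'I_m}, #|U| = k & 0 < qre (hdet_on U (A *m qadj A)).
Proof.
move=> rk; have [[S [cS indS]] _] := rk; rewrite -{k}cS in rk *.
have [U /right_indep_cols_adj] := row_indep_cols (right_indep_cols_adj indS).
rewrite qadjK => indU leU; have DU := hdet_on_gram_gt0 indU.
exists U => //; apply/eqP; rewrite eqn_leq leU andbT leqNgt; apply/negP => ltU.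
by rewrite (qrank_hdet_on0 rk ltU) ltxx in DU.
Qed.

Lemma sum_minors_neq0 m n (A : 'M[H]_(m, n)) k : qrank_is A k ->
  \sum_(U : {set 'I_m} | #|U| == k) hdet_on U (A *m qadj A) != 0.
Proof.
case/qrank_hdet_on_gt0=> U /eqP kU DU; apply: contraTneq DU => /(congr1 (@qre R)).
rewrite qre_sum (bigD1 U) //= => e; rewrite -leNgt -[leRHS]e lerDl.
by apply: sumr_ge0 => V _; exact: hdet_on_gram_ge0.
Qed.

End Rank.

(** * Orthogonality properties of the least squares solution and Cramer's rule *)

Section LeastSquares.
Variable R : rcfType.
Local Notation H := (quat R).

Lemma sqnormDZ n (p q : 'rV[H]_n) (h : H) :
  sqnorm (p + h *: q) = sqnorm p + qre (h * qconj ((p *m qadj q) 0 0)) *+ 2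
                        + qnorm2 h * sqnorm q.
Proof.
rewrite !sqnormE mulr_sumr mxE qconj_sum mulr_sumr qre_sum -sumrMnl -!big_split /=.
apply: eq_bigr => j _; rewrite !mxE.
by case: (p 0 j) (q 0 j) h => [????] [????] [????]; rewrite /qnorm2 /=; ring.
Qed.

(* Test the hypothesis at h = - t b, where b = p q^* and t = 1 / (1 + |q|^2). *)
Lemma minimal_orth n (p q : 'rV[H]_n) :
  (forall h : H, sqnorm p <= sqnorm (p + h *: q)) -> p *m qadj q = 0.
Proof.
move=> pmin; apply/matrixP => i j; rewrite [RHS]mxE !ord1 {i j}.
set b := (p *m qadj q) 0 0; pose s := sqnorm q.
have s0 : 0 <= s := sqnorm_ge0 q.
pose t := (1 + s)^-1.
have t0 : 0 < t by rewrite invr_gt0 ltr_wpDr.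
have ts : t * (1 + s) = 1 by rewrite mulVf // gt_eqF // ltr_wpDr.
have := pmin (- qreal t * b); rewrite sqnormDZ -/b -/s.
have -> : qre (- qreal t * b * qconj b) = - (t * qnorm2 b).
  by rewrite -mulrA; case: (b) => ????; rewrite /qnorm2 /=; ring.
have -> : qnorm2 (- qreal t * b) = t ^+ 2 * qnorm2 b.
  by case: (b) => ????; rewrite /qnorm2 /=; ring.
move=> h; apply/eqP; rewrite -qnorm2_eq0 eq_le qnorm2_ge0 andbT.
have N0 := qnorm2_ge0 b; move: (qnorm2 b) N0 h => N N0 h.
rewrite -(pmulr_rle0 _ t0).
(* As [t * s = 1 - t], the inequality reduces to [t * N + t ^+ 2 * N <= 0]. *)
have e : t ^+ 2 * N * s = t * N * (1 - t) by rewrite -[X in _ * (X - t)]ts; ring.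
rewrite e in h; have : 0 <= t * N * t by rewrite !mulr_ge0 // ltW.
by move=> ?; lra.
Qed.

Lemma ler_rnorm n (x y : 'rV[H]_n) : (rnorm x <= rnorm y) = (sqnorm x <= sqnorm y).
Proof. by rewrite /rnorm ler_psqrt // nnegrE sqnorm_ge0. Qed.

Variables (m n : nat) (A : 'M[H]_(m, n)) (y : 'rV[H]_n) (x0 : 'rV[H]_m).
Hypothesis lsq : lsq_least_norm A y x0.

(** The residual is orthogonal to [g *m A] for the direction [g], residual times [qadj A]; this
    inner product is the squared norm of [g]. *)
Lemma lsq_normal : x0 *m (A *m qadj A) = y *m qadj A.
Proof.
apply/eqP; rewrite mulmxA -subr_eq0 -mulmxBl; set g := _ *m _.
apply/eqP; apply: sqnorm_eq0; rewrite /sqnorm {1}/g -mulmxA -qadj_mul.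
rewrite (@minimal_orth _ (x0 *m A - y) (g *m A)) ?mxE // => h.
have := lsq.1 (x0 + h *: g); rewrite ler_rnorm.
by rewrite mulmxDl -scalemxAl addrAC.
Qed.

(** Moving [x0] along [v] leaves the residual unchanged, so the minimality of the norm of [x0]
    applies. *)
Lemma lsq_orth (v : 'rV[H]_m) : v *m A = 0 -> x0 *m qadj v = 0.
Proof.
move=> vA; apply: minimal_orth => h; rewrite -ler_rnorm; apply: lsq.2.
by rewrite mulmxDl -scalemxAl vA scaler0 addr0.
Qed.

Lemma lsq_cramer k i : qrank_is A k ->
  x0 0 i =
    (\sum_(U : {set 'I_m} | (#|U| == k) && (i \in U))
       rdet_on U i (row_repl (A *m qadj A) i (y *m qadj A))) *
    qinv (\sum_(U : {set 'I_m} | #|U| == k) hdet_on U (A *m qadj A)).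
Proof.
move=> rk; rewrite -lsq_normal.
have := sum_rdet_on_mulmx (gram_herm A) k i x0.
(* Each term over a set of size [k.+1] pairs [x0] with a cofactor column whose adjoint lies in the
   left kernel of [A]. *)
rewrite [X in _ + X]big1 ?addr0 => [->|U /andP[/eqP cU iU]].
  by rewrite -mulrA qmulV ?mulr1 ?sum_minors_neq0.
have := @cofactor_row_ker _ _ _ A U i iU (qrank_hdet_on0 rk _).
by rewrite cU => /(_ (ltnSn k))/lsq_orth; rewrite qadjK cofactor_colE // => ->; rewrite mxE.
Qed.

End LeastSquares.

Theorem theorem5p4 (R : rcfType) (m n : nat) (A : 'M[quat R]_(m, n))
    (y : 'rV[quat R]_n) (x0 : 'rV[quat R]_m) :
  lsq_least_norm A y x0 ->
  let z := y *m qadj A in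
  (qrank_is A m ->
     forall i : 'I_m,
       x0 0 i = rdet i (row_repl (A *m qadj A) i z) * qinv (ddet A)) /\
  (forall k : nat, qrank_is A k -> (k <= n)%N -> (n < m)%N ->
     forall i : 'I_m,
       x0 0 i =
         (\sum_(alpha : {set 'I_m} | (#|alpha| == k) && (i \in alpha))
             rdet_sub i (row_repl (A *m qadj A) i z) alpha) *
         qinv (\sum_(alpha : {set 'I_m} | #|alpha| == k)
                 hdet (psubmx (A *m qadj A) alpha))).
Proof.
move=> lsq z; split=> [rk i|k rk _ _ i].
  (* At full row rank the full index set is the only one of size [m], so both sums have one term. *)
  have cardT (U : {set 'I_m}) : (#|U| == m) = (U == setT).
    have := max_card (mem U); rewrite card_ord eqEcard subsetT cardsT card_ord.
    by rewrite eqn_leq => ->.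
  rewrite (lsq_cramer lsq i rk) /ddet rdet_onT hdet_onT.
  rewrite (big_pred1 setT) => [|U]; last first.
    by rewrite cardT /=; case: (U =P setT) => [->|]; rewrite ?inE.
  by rewrite (big_pred1 setT).
rewrite (lsq_cramer lsq i rk); congr (_ * qinv _).
  by apply: eq_bigr => U /andP[_ iU]; rewrite rdet_subE.
by apply: eq_bigr => U _; rewrite hdet_psubmx.
Qed.
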